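(* Let $\Omega\subset\mathbb{R}^3$ be a $C^1$ bounded domain. There exists $C_K>0$ such that for all $\zeta\in[1/2,1]$, $$\forall f\in L^\infty_{x,v}(\mu^{-\zeta}),\quad \|K(f)\|_{L^\infty_{x,v}(\nu^{-1}\mu^{-\zeta})}\leq C_K(\zeta)\,\|f\|_{L^\infty_{x,v}(\mu^{-\zeta})},$$ where $C_K(\zeta)=3+C_K(1-\zeta)$.
   Context: Maxwellian: $\mu(v)=(2\pi)^{-3/2}e^{-|v|^2/2}$. For a positive weight $w(v)$, $\|f\|_{L^\infty_{x,v}(w)}=\sup_{(x,v)\in\Omega\times\mathbb{R}^3}|f(x,v)|w(v)$. Collision kernel (standing assumptions): $B(|v-v_*|,\cos\theta)=C_\Phi|v-v_*|^\gamma b(\cos\theta)$, $C_\Phi>0$, $\gamma\in[0,1]$, $b\circ\cos$ positive and continuous on $(0,\pi)$, $\|b\|_{L^\infty([-1,1])}<\infty$. Here $v'=\frac{v+v_*}{2}+\frac{|v-v_*|}{2}\sigma$, $v'_*=\frac{v+v_*}{2}-\frac{|v-v_*|}{2}\sigma$, $\cos\theta=\langle\frac{v-v_*}{|v-v_*|},\sigma\rangle$, and $g'=g(v')$, $g'_*=g(v'_* )$, $g_*=g(v_* )$. The linear Boltzmann operator $$Lf=\int_{\mathbb{R}^3\times\mathbb{S}^2}B\,[\mu'f'_*+\mu'_*f'-\mu f_*-\mu_*f]\,dv_*d\sigma$$ is decomposed as $L=-\nu(v)+K$, where $\nu(v)=\int_{\mathbb{R}^3\times\mathbb{S}^2}B(|v-v_*|,\cos\theta)\mu_*\,d\sigma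 dv_*$ is the collision frequency, and therefore $$K(f)(v)=\int_{\mathbb{R}^3\times\mathbb{S}^2}B\,[\mu'f'_*+\mu'_*f'-\mu f_*]\,dv_*d\sigma.$$ $K$ acts on the velocity variable only. *)

(* Defs.v *)
From HB Require Import structures.
From mathcomp Require Import all_boot all_order all_algebra.
From mathcomp Require Import all_classical all_reals all_analysis.
From mathcomp Require Import measurable_realfun.

Set Implicit Arguments.
Unset Strict Implicit.
Unset Printing Implicit Defensive.

Import Order.TTheory GRing.Theory Num.Theory.
Import numFieldNormedType.Exports.

Local Open Scope classical_set_scope.
Local Open Scope ring_scope.

Notation vec3 R := (R * R * R)%type.

(* R^3 with its Borel sigma-algebra, over the copy of the reals that carries
   the library's Lebesgue measure; convertible to [vec3 R]. *)
Notation mvec3 R :=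
  (measurableTypeR R * measurableTypeR R * measurableTypeR R)%type.

Section Euclidean.
Context {R : realType}.
Implicit Types u v : vec3 R.

Definition dot3 u v : R := u.1.1 * v.1.1 + u.1.2 * v.1.2 + u.2 * v.2.

(* The library norm of a product is the sup norm, not the Euclidean one. *)
Definition norm3 v : R := Num.sqrt (dot3 v v).

Definition sphere2 : set (vec3 R) := [set s | norm3 s = 1].

End Euclidean.

(* The library has this instance, but shadowed by the one for products of
   subprobabilities. *)
Lemma product_measure_sigma_finite d1 d2 (T1 : measurableType d1)
    (T2 : measurableType d2) (R : realType)
    (m1 : {sigma_finite_measure set T1 -> \bar R})
    (m2 : {sigma_finite_measure set T2 -> \bar R}) :
  sigma_finite setT (m1 \x m2)%E.
Proof.
have /sigma_finiteP[F [TF ndF Foo]] := sigma_finiteT m1.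
have /sigma_finiteP[G [TG ndG Goo]] := sigma_finiteT m2.
exists (fun n => F n `*` G n).
  rewrite -setXTT TF TG predeqE => -[x y]; split.
    move=> [/= [n _ Fnx] [k _ Gky]]; exists (maxn n k) => //; split.
    - by move: x Fnx; exact/subsetPset/ndF/leq_maxl.
    - by move: y Gky; exact/subsetPset/ndG/leq_maxr.
  by move=> [n _ []/= ? ?]; split; exists n.
move=> k; have [? ?] := Foo k; have [? ?] := Goo k.
split; first exact: measurableX.
by rewrite product_measure1E// lte_mul_pinfty// ge0_fin_numE.
Qed.

Section Lebesgue.
Context (R : realType).
Local Notation mR := (measurableTypeR R).

Definition lebesgue2 : set (mR * mR)%type -> \bar R :=
  product_measure1 (@lebesgue_measure R) (@lebesgue_measure R).
HB.instance Definition _ := Measure.on lebesgue2.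
HB.instance Definition _ := Measure_isSigmaFinite.Build _ _ _ lebesgue2
  (product_measure_sigma_finite (@lebesgue_measure R) (@lebesgue_measure R)).

Definition lebesgue3 : set (mvec3 R) -> \bar R :=
  product_measure1 lebesgue2 (@lebesgue_measure R).
HB.instance Definition _ := Measure.on lebesgue3.
HB.instance Definition _ := Measure_isSigmaFinite.Build _ _ _ lebesgue3
  (product_measure_sigma_finite lebesgue2 (@lebesgue_measure R)).

End Lebesgue.
Arguments lebesgue2 : clear implicits.
Arguments lebesgue3 : clear implicits.

Section Surface_measure.
Context {R : realType}.
Local Notation mR := (measurableTypeR R).

(* [a.1] is the polar angle and [a.2] the azimuth, so the surface element is
   [sin a.1] times Lebesgue measure. *)
Definition spherical (a : mR * mR) : mvec3 R :=
  (sin a.1 * cos a.2, sin a.1 * sin a.2, cos a.1).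

Definition angles : set (mR * mR) := `[0, pi] `*` `[0, 2 * pi].

Definition surface_measure (A : set (mvec3 R)) : \bar R :=
  (\int[lebesgue2 R]_(a in angles `&` spherical @^-1` A) (sin a.1)%:E)%E.

Let mangles : measurable angles.
Proof. by apply: measurableX; exact: measurable_itv. Qed.

Let mspherical : measurable_fun setT spherical.
Proof.
have ms : measurable_fun setT (@sin R).
  by apply: continuous_measurable_fun; exact: continuous_sin.
have mc : measurable_fun setT (@cos R).
  by apply: continuous_measurable_fun; exact: continuous_cos.
have m1 (g : R -> R) : measurable_fun setT g ->
    measurable_fun setT (fun a : mR * mR => g a.1).
  move=> mg; exact: (measurableT_comp
    (mg : measurable_fun setT (g : mR -> R)) measurable_fst).
have m2 (g : R -> R) : measurable_fun setT g ->
    measurable_fun setT (fun a : mR * mR => g a.2).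
  move=> mg; exact: (measurableT_comp
    (mg : measurable_fun setT (g : mR -> R)) measurable_snd).
have mx : measurable_fun setT (fun a : mR * mR => sin a.1 * cos a.2).
  by apply: measurable_funM; [exact: m1|exact: m2].
have my : measurable_fun setT (fun a : mR * mR => sin a.1 * sin a.2).
  by apply: measurable_funM; [exact: m1|exact: m2].
exact: (measurable_fun_pair
  (measurable_fun_pair (mx : measurable_fun setT (_ : mR * mR -> mR))
                       (my : measurable_fun setT (_ : mR * mR -> mR)))
  (m1 _ mc : measurable_fun setT (_ : mR * mR -> mR))).
Qed.

Let mdom A : measurable A -> measurable (angles `&` spherical @^-1` A).
Proof.
move=> mA; apply: measurableI => //.
by rewrite -[X in measurable X]setTI; exact: mspherical.
Qed.

Let msin (D : set (mR * mR)) :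
  measurable_fun D (fun a : R * R => (sin a.1)%:E).
Proof.
apply: measurable_funTS; apply/measurable_EFinP.
have ms : measurable_fun setT (@sin R : mR -> R).
  exact: (continuous_measurable_fun (@continuous_sin R)).
exact: (measurableT_comp ms measurable_fst).
Qed.

Let sin_angles_ge0 a : angles a -> (0 <= (sin a.1)%:E)%E.
Proof.
case=> /= + _; rewrite in_itv /= => /andP[a0 api].
by rewrite lee_fin; apply: sin_ge0_pi; rewrite a0 api.
Qed.

Let surface_measure0 : surface_measure set0 = 0%E.
Proof. by rewrite /surface_measure preimage_set0 setI0 integral_set0. Qed.

Let surface_measure_ge0 A : (0 <= surface_measure A)%E.
Proof. by apply: integral_ge0 => a [aa _]; exact: sin_angles_ge0. Qed.

Let surface_measure_sigma_additive :
  semi_sigma_additive surface_measure.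
Proof.
move=> F mF tF mUF.
rewrite /surface_measure preimage_bigcup setI_bigcupr.
rewrite ge0_integral_bigcup//=.
- by apply: is_cvg_ereal_nneg_natsum_cond => n _ _; exact: surface_measure_ge0.
- by move=> k; exact: mdom.
- by move=> a [k _ [aa _]]; exact: sin_angles_ge0.
- apply/trivIsetP => i j _ _ ij; move/trivIsetP: tF => /(_ i j I I ij) Fij.
  by rewrite setIACA setIid -preimage_setI Fij preimage_set0 setI0.
Qed.

HB.instance Definition _ := isMeasure.Build _ _ _ surface_measure
  surface_measure0 surface_measure_ge0 surface_measure_sigma_additive.

Let surface_measure_fin : fin_num_fun surface_measure.
Proof.
move=> A mA; rewrite ge0_fin_numE//.
apply: (@le_lt_trans _ _ (lebesgue2 R angles)).
  rewrite -[leRHS]mul1e -integral_cst//.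
  apply: (@le_trans _ _ (\int[lebesgue2 R]_(a in angles `&` spherical @^-1` A)
                           cst 1%:E a)%E).
    apply: ge0_le_integral => //.
    - exact: mdom.
    - by move=> a [aa _]; exact: sin_angles_ge0.
    - by move=> a _; rewrite lee_fin sin_le1.
  apply: ge0_subset_integral => //; first exact: mdom.
rewrite [ltLHS](_ : _ = (@lebesgue_measure R `[0%R, pi]%classic *
                         @lebesgue_measure R `[0%R, (2 * pi)%R]%classic)%E); last first.
  by apply: product_measure1E; exact: measurable_itv.
rewrite !lebesgue_measure_itv/= !lte_fin.
by do 2 case: ifPn => _; rewrite ?mul0e ?mule0// ltry.
Qed.

HB.instance Definition _ := Measure_isFinite.Build _ _ _ surface_measure
  surface_measure_fin.

End Surface_measure.

Section Boltzmann.
Context {R : realType}.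
Implicit Types v w s : vec3 R.

Definition maxwellian v : R :=
  (2 * pi) `^ (- (3 / 2)) * expR (- (norm3 v ^+ 2 / 2)).

Definition post v w s : vec3 R :=
  2^-1 *: (v + w) + (norm3 (v - w) / 2) *: s.

Definition post_star v w s : vec3 R :=
  2^-1 *: (v + w) - (norm3 (v - w) / 2) *: s.

(* At [v = w] the angle is undefined and this is [0]; that set is negligible. *)
Definition cos_deviation v w s : R :=
  dot3 ((norm3 (v - w))^-1 *: (v - w)) s.

Definition hard_potential_cutoff (CPhi gamma : R) (b : R -> R) : Prop :=
  [/\ 0 < CPhi,
      0 <= gamma <= 1,
      forall theta, 0 < theta < pi ->
        0 < b (cos theta) /\ {for theta, continuous (b \o cos)} &
      ('N[@lebesgue_measure R]_+oo
         [(fun t => ((b \_ `[-1, 1]) t)%:E)%R] < +oo)%E].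

Definition collision_kernel (CPhi gamma : R) (b : R -> R) (r c : R) : R :=
  CPhi * r `^ gamma * b c.

(* Integration over R^3 x S^2 against dv_* dsigma. *)
Definition integral_vs (F : vec3 R -> vec3 R -> R) : R :=
  (\int[(lebesgue3 R \x @surface_measure R)%E]_(z in setT `*` sphere2)
     F z.1 z.2)%R.

Variable B : R -> R -> R.

Let Bk v w s := B (norm3 (v - w)) (cos_deviation v w s).

Definition collision_frequency v : R :=
  integral_vs (fun w s => Bk v w s * maxwellian w).

Definition K_op (g : vec3 R -> R) v : R :=
  integral_vs (fun w s => let v' := post v w s in let w' := post_star v w s in
    Bk v w s * (maxwellian v' * g w' + maxwellian w' * g v'
                - maxwellian v * g w)).

End Boltzmann.

Section Phase_space.
Context {R : realType}.

Definition C1_fun (phi : R * R -> R) : Prop :=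
  (forall y, differentiable phi y) /\
  (forall h, continuous (fun y => 'd phi y h)).

Definition orthonormal3 (e1 e2 e3 : vec3 R) : Prop :=
  [/\ norm3 e1 = 1, norm3 e2 = 1, norm3 e3 = 1 &
      [/\ dot3 e1 e2 = 0, dot3 e1 e3 = 0 & dot3 e2 e3 = 0]].

(* Near each boundary point, and in suitable orthonormal coordinates, the set
   is the region above the graph of a C^1 function. *)
Definition C1_boundary (Omega : set (vec3 R)) : Prop :=
  forall p, (closure Omega `\` interior Omega) p ->
  exists e1 e2 e3 (phi : R * R -> R) (r : R),
    [/\ orthonormal3 e1 e2 e3, C1_fun phi, 0 < r &
        forall x, norm3 (x - p) < r ->
          (Omega x <-> phi (dot3 x e1, dot3 x e2) < dot3 x e3)].

Definition C1_bounded_domain (Omega : set (vec3 R)) : Prop :=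
  [/\ open Omega, connected Omega, Omega !=set0, bounded_set Omega &
      C1_boundary Omega].

Definition sup_norm (Omega : set (vec3 R)) (weight : vec3 R -> R)
    (f : vec3 R * vec3 R -> R) : \bar R :=
  ereal_sup [set (`|f z| * weight z.2)%:E | z in Omega `*` setT].

Definition in_Linfty (Omega : set (vec3 R)) (weight : vec3 R -> R)
    (f : vec3 R * vec3 R -> R) : Prop :=
  measurable_fun (Omega `*` setT : set (mvec3 R * mvec3 R)) f /\
  (sup_norm Omega weight f < +oo)%E.

End Phase_space.

(* Main.v *)
(* With |f| <= M mu^zeta, conservation of energy bounds each of the three
   products in K(f) by M mu(v)^zeta c e^{-zeta |v_*|^2/2}, c = (2 pi)^{-3/2},
   once a factor e^{-(1-zeta)|.|^2/2} <= 1 is dropped.  With x = |v_*|^2/2 and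
   zeta >= 1/2, e^{-zeta x} <= e^{-x} + (1-zeta) x e^{-x/2}, so that
     |K(f)(v)| <= 3 M mu(v)^zeta (nu(v) + (1-zeta) D(v)),
   where D is the analogue of nu with weight c x e^{-x/2}.  Both nu(v) and D(v)
   are comparable to (1+|v|^2)^{gamma/2}: for the upper bound b is bounded off
   the null set of grazing collisions; for the lower bound, restrict v_* to a
   unit cube on the opposite side of the origin from v, where
   |v-v_*|^2 >= 1+|v|^2, and sigma to directions transverse to v-v_*, where b is
   bounded below. *)

Require Import Defs.
From HB Require Import structures.
From mathcomp Require Import all_boot all_order all_algebra.
From mathcomp Require Import all_classical all_reals all_analysis.
From mathcomp Require Import ring lra measurable_realfun.
Import Order.TTheory GRing.Theory Num.Theory.
Import numFieldNormedType.Exports.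
Local Open Scope classical_set_scope.
Local Open Scope ring_scope.

Section NegligibleIntegral.
Context {d} {T : measurableType d} {R : realType}.
Context {mu : {measure set T -> \bar R}} {D N : set T}.
Hypotheses (mN : measurable N) (N0 : mu N = 0%E).
Local Open Scope ereal_scope.
Import HBNNSimple.

Lemma ge0_le_integral_off_null (f g : T -> \bar R) :
  (forall x, D x -> 0 <= f x) -> (forall x, D x -> 0 <= g x) ->
  (forall x, D x -> ~ N x -> f x <= g x) ->
  \int[mu]_(x in D) f x <= \int[mu]_(x in D) g x.
Proof.
move=> f0 g0 fg; rewrite !ge0_integralE//.
apply: ge_ereal_sup => _ [h /= hf <-].
pose k := proj_nnsfun h (measurableC mN).
have kE x : k x = if x \in N then 0%R else h x.
  rewrite /k /proj_nnsfun /= mindicE in_setC.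
  by case: (x \in N); rewrite ?mulr0 ?mulr1.
have hk : sintegral mu h = sintegral mu k.
  rewrite -!integralT_nnsfun; apply: ge0_ae_eq_integral => //.
  - by apply/measurable_EFinP; exact: measurable_funP.
  - by apply/measurable_EFinP; exact: measurable_funP.
  - by move=> x _; rewrite lee_fin.
  - by move=> x _; rewrite lee_fin.
  - exists N; split => // x /= => xk; apply: contrapT => Nx; apply: xk => _.
    by rewrite -[RHS]/((k x)%:E) kE memNset.
apply: ereal_sup_ubound; exists k => //= x.
rewrite -[leLHS]/((k x)%:E) kE; have [xN|xN] := boolP (x \in N).
  by rewrite patchE; case: ifPn => //; rewrite inE => /g0.
rewrite patchE; have := hf x; rewrite patchE.
case: ifPn => // xD hx; apply: (le_trans hx); apply: fg; first exact: set_mem.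
by move/mem_set; rewrite (negbTE xN).
Qed.

Lemma abse_integral_le_off_null (f g : T -> \bar R) :
  (forall x, D x -> 0 <= g x) ->
  (forall x, D x -> ~ N x -> `|f x| <= g x) ->
  `|\int[mu]_(x in D) f x| <= \int[mu]_(x in D) g x.
Proof.
move=> g0 fg; rewrite integralE.
have p0 : 0 <= \int[mu]_(x in D) f^\+ x by exact: integral_ge0.
have n0 : 0 <= \int[mu]_(x in D) f^\- x by exact: integral_ge0.
have pg : \int[mu]_(x in D) f^\+ x <= \int[mu]_(x in D) g x.
  apply: ge0_le_integral_off_null => // x Dx Nx; apply: le_trans (fg x Dx Nx).
  by rewrite funeposE ge_max lee_abs abse_ge0.
have ng : \int[mu]_(x in D) f^\- x <= \int[mu]_(x in D) g x.
  apply: ge0_le_integral_off_null => // x Dx Nx; apply: le_trans (fg x Dx Nx).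
  by rewrite funenegE ge_max -abseN lee_abs abse_ge0.
move: p0 n0 pg ng.
move: (integral _ _ f^\+) (integral _ _ f^\-) (integral _ _ g) => a b c.
case: c => [c| |] => [|_ _ _ _|a0 _]; [|by rewrite leey|by rewrite leNgt (lt_le_trans _ a0)].
case: a => [a| |] //; case: b => [b| |] //; rewrite !lee_fin => a0 b0 ac bc.
by rewrite ler_norml; apply/andP; split; lra.
Qed.

Lemma eq_integral_off_null (f g : T -> \bar R) :
  (forall x, D x -> ~ N x -> f x = g x) ->
  \int[mu]_(x in D) f x = \int[mu]_(x in D) g x.
Proof.
move=> fg; rewrite integralE [RHS]integralE.
have E (u : T -> \bar R) (w : T -> \bar R) :
    (forall x, 0 <= u x) -> (forall x, 0 <= w x) ->
    (forall x, D x -> ~ N x -> u x = w x) ->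
    \int[mu]_(x in D) u x = \int[mu]_(x in D) w x.
  move=> u0 w0 uw; apply/eqP; rewrite eq_le; apply/andP; split;
    by apply: ge0_le_integral_off_null => // x Dx Nx; rewrite uw.
by congr (_ - _); apply: E => // x Dx Nx; rewrite ?funeposE ?funenegE fg.
Qed.

End NegligibleIntegral.

Section Collisions.
Context {R : realType}.
Implicit Types u v w s : vec3 R.

Lemma dot3_ge0 v : 0 <= dot3 v v.
Proof. by rewrite /dot3 -!expr2 !addr_ge0 ?sqr_ge0. Qed.

Lemma norm3_ge0 v : 0 <= norm3 v.
Proof. exact: sqrtr_ge0. Qed.

Lemma sqr_norm3 v : norm3 v ^+ 2 = dot3 v v.
Proof. by rewrite /norm3 sqr_sqrtr// dot3_ge0. Qed.

Lemma dot3_sqr_le u v : dot3 u v ^+ 2 <= dot3 u u * dot3 v v.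
Proof.
case: u => [[a b] c]; case: v => [[x y] z]; rewrite /dot3 /= -subr_ge0.
rewrite [leRHS](_ : _ = (a * y - b * x) ^+ 2 + (a * z - c * x) ^+ 2 +
  (b * z - c * y) ^+ 2); last by ring.
by rewrite !addr_ge0 ?sqr_ge0.
Qed.

Lemma dot3_scalel (k : R) u v : dot3 (k *: u) v = k * dot3 u v.
Proof.
case: u => [[a b] c]; case: v => [[x y] z].
by rewrite /dot3 /= /GRing.scale /=; ring.
Qed.

Lemma sphere2_dot3 s : sphere2 s -> dot3 s s = 1.
Proof. by rewrite /sphere2 /= -sqr_norm3 => ->; rewrite expr1n. Qed.

Lemma dot3_direction_le1 v w :
  dot3 ((norm3 (v - w))^-1 *: (v - w)) ((norm3 (v - w))^-1 *: (v - w)) <= 1.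
Proof.
set u := v - w.
have -> : dot3 ((norm3 u)^-1 *: u) ((norm3 u)^-1 *: u) =
          (norm3 u)^-1 ^+ 2 * norm3 u ^+ 2.
  rewrite sqr_norm3; case: u => [[a b] c].
  by rewrite /dot3 /= /GRing.scale /=; ring.
rewrite -exprMn; have [->|u0] := eqVneq (norm3 u) 0.
  by rewrite mulr0 expr0n ler01.
by rewrite mulVf// expr1n.
Qed.

Lemma collision_energy v w s : sphere2 s ->
  dot3 (post v w s) (post v w s) + dot3 (post_star v w s) (post_star v w s) =
  dot3 v v + dot3 w w.
Proof.
move=> /sphere2_dot3 s1; rewrite /post /post_star.
have := sqr_norm3 (v - w); move: (norm3 _) => r; move: s1.
case: v => [[a b] c]; case: w => [[x y] z]; case: s => [[p q] t].
rewrite /dot3 /= /GRing.scale /= => s1 rE.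
rewrite [LHS](_ : _ = 2^-1 * ((a + x) ^+ 2 + (b + y) ^+ 2 + (c + z) ^+ 2)
   + 2^-1 * r ^+ 2 * (p * p + q * q + t * t)); last by field.
by rewrite s1 rE; field.
Qed.

End Collisions.

Section Maxwellian.
Context {R : realType}.
Implicit Types v w s : vec3 R.

Lemma maxwellian0_gt0 : 0 < (2 * pi) `^ (- (3 / 2)) :> R.
Proof. by rewrite powR_gt0// mulr_gt0// pi_gt0. Qed.

Lemma maxwellian_gt0 v : 0 < maxwellian v.
Proof. by rewrite mulr_gt0 ?expR_gt0// maxwellian0_gt0. Qed.

Lemma maxwellian_powR v (z : R) :
  maxwellian v `^ z = ((2 * pi) `^ (- (3 / 2))) `^ z * expR (- (z * dot3 v v / 2)).
Proof.
rewrite /maxwellian powRM ?ltW ?expR_gt0 ?maxwellian0_gt0//; congr (_ * _).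
by rewrite -expRM sqr_norm3; congr expR; ring.
Qed.

Lemma maxwellian_mul_powR_le (z : R) v w v' w' : 0 <= z <= 1 ->
  dot3 v' v' + dot3 w' w' = dot3 v v + dot3 w w ->
  maxwellian v' * maxwellian w' `^ z <=
  maxwellian v `^ z * ((2 * pi) `^ (- (3 / 2)) * expR (- (z * dot3 w w / 2))).
Proof.
move=> /andP[z0 z1] E; rewrite !maxwellian_powR {1}/maxwellian sqr_norm3.
set c := _ `^ (- (3 / 2)); have c0 : 0 < c by exact: maxwellian0_gt0.
rewrite -subr_ge0.
have -> : c `^ z * expR (- (z * dot3 v v / 2)) * (c * expR (- (z * dot3 w w / 2))) -
  c * expR (- (dot3 v' v' / 2)) * (c `^ z * expR (- (z * dot3 w' w' / 2))) =
  c * c `^ z * (expR (- (z * dot3 v v / 2)) * expR (- (z * dot3 w w / 2)) -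
     expR (- (dot3 v' v' / 2)) * expR (- (z * dot3 w' w' / 2))) by ring.
have cz0 : 0 <= c * c `^ z by rewrite mulr_ge0 ?powR_ge0 ?ltW.
rewrite mulr_ge0// subr_ge0 -!expRD ler_expR.
have := mulr_ge0 (_ : 0 <= 1 - z) (dot3_ge0 v').
by rewrite subr_ge0 z1 => /(_ isT); nra.
Qed.

Lemma gaussian_taylor (a x : R) : 0 <= a <= 1 / 2 -> 0 <= x ->
  expR (- ((1 - a) * x)) <= expR (- x) + a * (x * expR (- (x / 2))).
Proof.
move=> /andP[a0 a1] x0; set e := expR (- ((1 - a) * x)).
have h1 : e * (1 + - (a * x)) <= expR (- x).
  rewrite (_ : - x = - ((1 - a) * x) + - (a * x)); last by ring.
  by rewrite expRD ler_wpM2l ?expR_ge0// expR_ge1Dx.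
have h2 : e <= expR (- (x / 2)) by rewrite ler_expR; nra.
have := ler_wpM2l (mulr_ge0 a0 x0) h2.
by nra.
Qed.

Lemma gaussian_moment_le (x : R) : 0 <= x ->
  x * (1 + 2 * x) * expR (- (x / 2)) <= 128 * expR (- (x / 4)).
Proof.
move=> x0; rewrite (_ : - (x / 4) = - (x / 2) + (x / 8 + x / 8)); last by field.
rewrite !expRD [leRHS]mulrCA mulrC ler_wpM2l ?expR_ge0//.
have := expR_ge1Dx (x / 8); move: (expR _) => e he.
have : (1 + x / 8) ^+ 2 <= e * e.
  by rewrite expr2 ler_pM ?addr_ge0 ?divr_ge0.
by nra.
Qed.

End Maxwellian.

Section AngularKernel.
Context {R : realType}.
Variables (CPhi gamma : R) (b : R -> R).
Hypothesis hB : hard_potential_cutoff CPhi gamma b.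

Lemma acos_itv (t : R) : -1 < t < 1 -> 0 < acos t < pi.
Proof.
by move=> /andP[t1 t2]; rewrite acos_gt0 ?acos_ltpi ?t1 ?t2 ?ltW.
Qed.

Lemma angular_gt0 t : -1 < t < 1 -> 0 < b t.
Proof.
move=> t1; have [_ _ /(_ (acos t))] := hB.
rewrite acos_itv// => /(_ isT)[+ _] _; rewrite acosK//.
by rewrite in_itv /=; case/andP: t1 => ? ?; rewrite !ltW.
Qed.

Lemma angular_continuous t : -1 < t < 1 -> {for t, continuous b}.
Proof.
move=> t1; have [_ _ /(_ (acos t))] := hB.
rewrite acos_itv// => /(_ isT)[_ cb] _.
have E : \forall x \near t, (b \o cos) (acos x) = b x.
  near=> x; rewrite /= acosK// in_itv /=.
  have : x \in `]-1, 1[ by near: x; apply: near_in_itvoo; rewrite in_itv.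
  by rewrite in_itv /= => /andP[? ?]; rewrite !ltW.
rewrite /prop_for /continuous_at -(nbhs_singleton E).
apply: cvg_trans; first by apply: near_eq_cvg; exact: E.
apply: (@continuous_comp _ _ _ (@acos R) (b \o cos)) => //.
exact: continuous_acos.
Unshelve. all: by end_near. Qed.

Lemma measurable_angular : measurable_fun setT (b \_ `]-1, 1[ : R -> R).
Proof.
apply/(measurable_restrictT _ _).1 => //.
apply: open_continuous_measurable_fun => //.
by move=> t; rewrite inE/= in_itv /=; exact: angular_continuous.
Qed.

Lemma angular_lower_bound : exists2 b0 : R, 0 < b0 &
  forall t, -(9 / 10) <= t <= 9 / 10 -> b0 <= b t.
Proof.
have [||c cI cmin] := @EVT_min R b (- (9 / 10)) (9 / 10).
- by lra.
- apply: continuous_in_subspaceT => t; rewrite inE /= in_itv /= => ?.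
  by apply: angular_continuous; lra.
exists (b c) => [|t tI]; last exact: cmin.
by apply: angular_gt0; move: cI; rewrite in_itv /=; lra.
Qed.

Lemma angular_upper_bound : exists2 M : R, 0 < M &
  forall t, -1 < t < 1 -> b t <= M.
Proof.
have [_ _ _] := hB; rewrite unlock /Lnorm.
have lT : (0 < @lebesgue_measure R setT)%E.
  apply: (@lt_le_trans _ _ (@lebesgue_measure R `[0, 1]%classic)); last first.
    by apply: le_measure; rewrite ?inE.
  by rewrite lebesgue_measure_itv /= lte_fin ltr01 sube0 lte_fin ltr01.
rewrite lT => /ereal_inf_lt[y /= yae yoo].
have [M [M0 hM]] : exists M : R, 0 < M /\ (y <= M%:E)%E.
  case: y yoo {yae} => [r _| |_] //; last by exists 1; rewrite leNye.
  by exists (Num.max r 1); rewrite lt_max ltr01 orbT lee_fin le_max lexx.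
exists M => // t t1; rewrite leNgt; apply/negP => Mt.
have [N [mN N0 hN]] := yae.
have : \forall x \near t, M < b x /\ -1 < x < 1.
  near=> x; split.
    near: x; exact: (cvgr_gt _ (angular_continuous t t1)) Mt.
  have : x \in `]-1, 1[ by near: x; apply: near_in_itvoo; rewrite in_itv.
  by rewrite in_itv.
move=> /nbhs_ballP[e /= e0 he].
have : (@lebesgue_measure R (ball t e) <= @lebesgue_measure R N)%E.
  apply: le_measure; rewrite ?inE//; first exact: measurable_ball.
  move=> x /he[bx x1]; apply: hN => /=; apply/negP; rewrite -ltNge.
  rewrite (le_lt_trans hM)// patchE mem_set/=; last first.
    by rewrite in_itv /=; case/andP: x1 => ? ?; rewrite !ltW.
  by rewrite lte_fin (lt_le_trans bx)// ler_norm.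
by rewrite N0 lebesgue_measure_ball; [rewrite lee_fin leNgt mulrn_wgt0|exact: ltW].
Unshelve. all: by end_near. Qed.

End AngularKernel.

Section Measurability.
Context {R : realType} {d : measure_display} {T : measurableType d}.
Implicit Types f g : T -> mvec3 R.

Lemma measurable_fst_fst f : measurable_fun setT f ->
  measurable_fun setT (fun x => (f x).1.1 : R).
Proof.
by move=> mf; apply: (measurableT_comp measurable_fst);
  exact: (measurableT_comp measurable_fst).
Qed.

Lemma measurable_fst_snd f : measurable_fun setT f ->
  measurable_fun setT (fun x => (f x).1.2 : R).
Proof.
by move=> mf; apply: (measurableT_comp measurable_snd);
  exact: (measurableT_comp measurable_fst).
Qed.

Lemma measurable_snd3 f : measurable_fun setT f ->
  measurable_fun setT (fun x => (f x).2 : R).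
Proof. by move=> mf; exact: (measurableT_comp measurable_snd). Qed.

Lemma measurable_dot3 f g : measurable_fun setT f -> measurable_fun setT g ->
  measurable_fun setT (fun x => dot3 (f x) (g x)).
Proof.
move=> mf mg; apply: measurable_funD; first apply: measurable_funD;
  apply: measurable_funM;
  by [exact: measurable_fst_fst|exact: measurable_fst_snd|exact: measurable_snd3].
Qed.

Lemma measurable_norm3 f : measurable_fun setT f ->
  measurable_fun setT (fun x => norm3 (f x)).
Proof.
move=> mf; apply: (measurableT_comp (continuous_measurable_fun (@sqrt_continuous R))).
exact: measurable_dot3.
Qed.

Lemma measurable_sub3 (v : vec3 R) f : measurable_fun setT f ->
  measurable_fun setT (fun x => v - f x : mvec3 R).
Proof.
move=> mf; apply: measurable_fun_pair; first apply: measurable_fun_pair;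
  apply: measurable_funB => //;
  by [exact: measurable_fst_fst|exact: measurable_fst_snd|exact: measurable_snd3].
Qed.

Lemma measurable_cos_deviation (v : vec3 R) f g :
  measurable_fun setT f -> measurable_fun setT g ->
  measurable_fun setT (fun x => cos_deviation v (f x) (g x)).
Proof.
move=> mf mg.
rewrite (_ : (fun x => _) = fun x =>
  norm3 (v - f x) `^ (-1) * dot3 (v - f x) (g x)); last first.
  by apply/funext => x; rewrite /cos_deviation dot3_scalel powR_inv1 ?norm3_ge0.
have ms := measurable_sub3 v f mf.
apply: measurable_funM; last exact: measurable_dot3.
exact: (measurableT_comp (measurable_powR _) (measurable_norm3 _ ms)).
Qed.

Lemma measurable_preimage_sphere2 f : measurable_fun setT f ->
  measurable [set x | sphere2 (f x)].
Proof.
move=> mf; have := measurable_norm3 f mf.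
by move=> /(_ measurableT [set 1] (measurable_set1 1)); rewrite setTI.
Qed.

End Measurability.

Section SphereMass.
Context {R : realType}.
Local Notation mR := (measurableTypeR R).

Lemma surface_measure_pair_null (A : set (mvec3 R)) (p q : vec3 R) :
  (forall s, A s -> s = p \/ s = q) -> surface_measure A = 0%E.
Proof.
move=> hA; pose N : set (mR * mR) := [set acos p.2; acos q.2] `*` setT.
have mpq : measurable ([set acos p.2; acos q.2] : set mR).
  by apply: measurableU; exact: measurable_set1.
have N0 : lebesgue2 R N = 0%E.
  transitivity (@lebesgue_measure R [set acos p.2; acos q.2] *
    @lebesgue_measure R setT)%E; first exact: product_measure1E.
  rewrite countable_lebesgue_measure0 ?mul0e//.
  by apply: finite_set_countable; exact: finite_set2.
have mN : measurable N by exact: measurableX.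
apply/eqP; rewrite -abse_eq0 eq_le abse_ge0 andbT.
rewrite -[leRHS](@integral0 _ _ _ (lebesgue2 R) (angles `&` spherical @^-1` A)).
apply: (abse_integral_le_off_null mN N0) => //.
move=> [t f] [[/= tI _] /hA sA] Nt; exfalso; apply: Nt; split => //=.
by rewrite -(cosK tI); case: sA => <-; [left|right].
Qed.

Lemma surface_measure_ge_rectangle (A : set (mvec3 R)) (t1 t2 p k : R) :
  0 <= k -> 0 <= t1 -> t1 <= t2 -> t2 <= pi -> 0 <= p -> p <= 2 * pi ->
  (forall t f, t1 <= t <= t2 -> 0 <= f <= p ->
     k <= sin t /\ A (spherical (t, f))) ->
  ((k * ((t2 - t1) * p))%:E <= surface_measure A)%E.
Proof.
move=> k0 t10 t12 t2p p0 p2 h.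
pose P : set (mR * mR) := `[t1, t2]%classic `*` `[0, p]%classic.
have mP : measurable P by apply: measurableX; exact: measurable_itv.
have -> : (k * ((t2 - t1) * p))%:E = (\int[lebesgue2 R]_(a in P) (cst k%:E a))%E.
  rewrite integral_cst// [X in (_ * X)%E](_ : _ = (@lebesgue_measure R `[t1, t2]%classic *
      @lebesgue_measure R `[0%R, p]%classic)%E); last first.
    by apply: product_measure1E; exact: measurable_itv.
  rewrite !lebesgue_measure_itv/= !lte_fin EFinM; congr (_ * _)%E.
  have [t12'|] := ltP t1 t2; last first.
    by move=> ?; rewrite mul0e (_ : t2 - t1 = 0) ?mul0r//; lra.
  have [p0'|] := ltP 0 p; first by rewrite -!EFinD -EFinM oppr0 addr0.
  by move=> ?; rewrite mule0 (_ : p = 0) ?mulr0//; lra.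
rewrite /surface_measure integral_mkcond [leRHS]integral_mkcond.
have PA a : P a -> [/\ k <= sin a.1, angles a & A (spherical a)].
  case: a => t f [/=]; rewrite !in_itv /= => tI fI; have [ks As] := h t f tI fI.
  split => //; split => /=; rewrite in_itv /=.
    by move: tI => /andP[? ?]; apply/andP; split; lra.
  by move: fI => /andP[? ?]; apply/andP; split; lra.
apply: (ge0_le_integral_off_null measurable0 (measure0 _)).
- by move=> a _; apply: erestrict_ge0 => x _; rewrite lee_fin.
- move=> a _; apply: erestrict_ge0 => x [[/= + _] _]; rewrite in_itv/= => ?.
  by rewrite lee_fin sin_ge0_pi.
move=> a _ _; rewrite !patchE.
have [/set_mem/PA[ks aa Aa]|_] := boolP (a \in P).
  by rewrite mem_set ?lee_fin.
case: ifPn => // /set_mem[[/= + _] _]; rewrite in_itv/= => ?.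
by rewrite lee_fin sin_ge0_pi.
Qed.

(* Whatever the direction of [u], either the cap of the sphere around the north
   pole or the patch around (1, 0, 0) consists of vectors far from +-[u]. *)
Lemma surface_measure_transverse : exists2 m : R, 0 < m &
  forall u : vec3 R, dot3 u u <= 1 ->
  (m%:E <= surface_measure [set s : mvec3 R | sphere2 s /\
            (-(9 / 10) <= dot3 u s <= 9 / 10)%R])%E.
Proof.
pose q : R := 399 / 400; pose dl : R := acos q.
have pi0 := @pi_gt0 R.
have qI : -1 <= q <= 1 by rewrite /q; lra.
have cdl : cos dl = q by rewrite acosK// in_itv.
have dl0 : 0 < dl by rewrite acos_gt0// /q; lra.
have dlpi : dl <= pi by rewrite acos_lepi.
have dlpi2 : dl < pi / 2.
  have -> : (dl < pi / 2) = (cos (pi / 2) < cos dl).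
    by rewrite ltr_cos// in_itv /=; apply/andP; split; lra.
  by rewrite cos_pihalf cdl /q; lra.
have cosge t : 0 <= t <= dl -> q <= cos t.
  move=> /andP[t0 td]; rewrite -cdl leNgt ltr_cos ?in_itv/= -?leNgt//.
  - by apply/andP; split; lra.
  - by apply/andP; split; lra.
have unit_spherical a : sphere2 (spherical a : mvec3 R).
  rewrite /sphere2 /= /norm3 /dot3 /=.
  rewrite (_ : _ + _ = sin a.1 ^+ 2 * (cos a.2 ^+ 2 + sin a.2 ^+ 2) +
    cos a.1 ^+ 2); last by ring.
  by rewrite cos2Dsin2 mulr1 addrC cos2Dsin2 sqrtr1.
have sdl : 0 < sin (dl / 2) by apply: sin_gt0_pi; apply/andP; split; lra.
exists (Num.min (sin (dl / 2) * ((dl - dl / 2) * dl)) (q * ((pi / 2 - (pi / 2 - dl)) * dl))).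
  have q0 : 0 < q by rewrite /q; lra.
  have d1 : 0 < dl - dl / 2 by lra.
  have d2 : 0 < pi / 2 - (pi / 2 - dl) by lra.
  by rewrite lt_min; apply/andP; split; apply: mulr_gt0 => //; exact: mulr_gt0.
move=> u uu.
have near_le (e s : vec3 R) (k k' : R) : dot3 u e ^+ 2 <= k ^+ 2 -> 0 <= k ->
    0 <= k' -> dot3 (s - e) (s - e) <= k' ^+ 2 -> k + k' <= 9 / 10 ->
    -(9 / 10) <= dot3 u s <= 9 / 10.
  move=> ue k0 k'0 se kk.
  have h1 : `|dot3 u e| <= k by rewrite -ler_sqr ?nnegrE// real_normK ?num_real.
  have h2 : `|dot3 u (s - e)| <= k'.
    rewrite -ler_sqr ?nnegrE// real_normK ?num_real//.
    apply: (le_trans (dot3_sqr_le _ _)); apply: le_trans se.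
    by rewrite ler_piMl ?dot3_ge0.
  rewrite -ler_norml; have -> : dot3 u s = dot3 u e + dot3 u (s - e).
    by case: (u) (e) (s) => [[? ?] ?] [[? ?] ?] [[? ?] ?]; rewrite /dot3 /=; ring.
  by rewrite (le_trans (ler_normD _ _))//; lra.
have [u3|u3] := lerP (u.2 ^+ 2) ((4 / 5) ^+ 2).
  rewrite (@le_trans _ _ (sin (dl / 2) * ((dl - dl / 2) * dl))%:E)//.
    by rewrite lee_fin ge_min lexx.
  apply: surface_measure_ge_rectangle; rewrite ?ltW//; try lra.
  move=> t f /andP[t1 t2] _; split.
    rewrite leNgt ltr_sin ?in_itv/= -?leNgt//; apply/andP; split; lra.
  split; first exact: unit_spherical.
  apply: (near_le (0, 0, 1) _ (4 / 5) (1 / 10)); try lra.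
    by rewrite /dot3 /= !mulr0 !add0r mulr1.
  have cq : q <= cos t by apply: cosge; lra.
  rewrite /dot3 /= [leLHS](_ : _ = sin t ^+ 2 * (cos f ^+ 2 + sin f ^+ 2) +
    (cos t - 1) ^+ 2); last by ring.
  by rewrite cos2Dsin2; have := cos2Dsin2 t; move: cq; rewrite /q; lra.
rewrite (@le_trans _ _ (q * ((pi / 2 - (pi / 2 - dl)) * dl))%:E)//.
  by rewrite lee_fin ge_min lexx orbT.
apply: surface_measure_ge_rectangle; try (rewrite ?/q; lra).
move=> t f /andP[t1 t2] f1.
have sq : q <= sin t.
  by rewrite -cosBpihalf -cosN opprB; apply: cosge; lra.
split => //; split; first exact: unit_spherical.
apply: (near_le (1, 0, 0) _ (3 / 5) (3 / 10)); try lra.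
  rewrite /dot3 /= !mulr0 !addr0 mulr1.
  by move: uu u3; rewrite /dot3; have := sqr_ge0 u.1.2; lra.
have cq : q <= cos f by apply: cosge; lra.
have : q * q <= sin t * cos f by apply: ler_pM => //; rewrite /q; lra.
move=> qq; rewrite /dot3 /= [leLHS](_ : _ = sin t ^+ 2 * (cos f ^+ 2 + sin f ^+ 2) +
  cos t ^+ 2 + 1 - 2 * (sin t * cos f)); last by ring.
by rewrite cos2Dsin2; have := cos2Dsin2 t; move: qq; rewrite /q; lra.
Qed.

End SphereMass.

Section ProductIntegrals.
Context {R : realType}.
Local Notation mR := (measurableTypeR R).

Lemma integral_product_measure_mul d1 d2 (T1 : measurableType d1)
    (T2 : measurableType d2) (m1 : {sigma_finite_measure set T1 -> \bar R})
    (m2 : {sigma_finite_measure set T2 -> \bar R}) (f : T1 -> R) (g : T2 -> R) :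
  measurable_fun setT f -> measurable_fun setT g ->
  (forall x, 0 <= f x) -> (forall y, 0 <= g y) ->
  (\int[(m1 \x m2)%E]_z (f z.1 * g z.2)%:E =
   \int[m1]_x (f x)%:E * \int[m2]_y (g y)%:E)%E.
Proof.
move=> mf mg f0 g0; rewrite fubini_tonelli1/=; last 2 first.
- by apply/measurable_EFinP; apply: measurable_funM;
    [exact: (measurableT_comp mf)|exact: (measurableT_comp mg)].
- by move=> z; rewrite lee_fin mulr_ge0.
rewrite -ge0_integralZr//; first last.
- by apply: integral_ge0 => y _; rewrite lee_fin.
- by move=> x _; rewrite lee_fin.
- exact/measurable_EFinP.
apply: eq_integral => x _; rewrite /fubini_F -ge0_integralZl//.
- exact/measurable_EFinP.
- by move=> y _; rewrite lee_fin.
- by rewrite lee_fin.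
Qed.

Lemma measurable_gaussian (k : R) :
  measurable_fun setT (fun x : mR => expR (- (x ^+ 2 / k))).
Proof.
apply: (measurableT_comp (@measurable_expR R)); apply: measurable_funN.
by apply: measurable_funM => //; exact: measurable_funX.
Qed.

Lemma integral_gaussian_lty :
  (\int[@lebesgue_measure R]_x (expR (- (x ^+ 2 / 8)))%:E < +oo)%E.
Proof.
have n2 : 2 != 0 :> R by [].
have p0 := normal_peak_gt0 n2.
rewrite (eq_integral (fun x : mR => (normal_peak 2)^-1%:E * (normal_pdf 0 2 x)%:E)%E).
  rewrite ge0_integralZl//; first by rewrite integral_normal_pdf mule1 ltry.
  - by apply/measurable_EFinP; exact: measurable_normal_pdf.
  - by move=> x _; rewrite lee_fin normal_pdf_ge0.
  - by rewrite lee_fin invr_ge0 ltW.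
move=> x _; rewrite normal_pdfE// -EFinM mulKf ?gt_eqF//.
by congr (expR _)%:E; rewrite subr0; field.
Qed.

Lemma integral_gaussian3_lty :
  (\int[(lebesgue3 R \x @surface_measure R)%E]_z
     (expR (- (dot3 z.1 z.1 / 8)))%:E < +oo)%E.
Proof.
pose g (x : mR) : R := expR (- (x ^+ 2 / 8)).
have mg : measurable_fun setT g by exact: measurable_gaussian.
have g0 x : 0 <= g x by exact: expR_ge0.
pose g2 (x : mR * mR) : R := g x.1 * g x.2.
have mg2 : measurable_fun setT g2.
  by apply: measurable_funM; exact: (measurableT_comp mg).
have g20 x : 0 <= g2 x by rewrite mulr_ge0.
pose g3 (x : mvec3 R) : R := g2 x.1 * g x.2.
have mg3 : measurable_fun setT g3.
  by apply: measurable_funM; [exact: (measurableT_comp mg2)|exact: (measurableT_comp mg)].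
have g30 x : 0 <= g3 x by rewrite mulr_ge0.
rewrite (eq_integral (fun z : mvec3 R * mvec3 R => (g3 z.1 * cst 1 z.2)%:E)); last first.
  move=> [[[x y] z] s] _; rewrite /g3 /g2 /g /dot3 /= mulr1 -!expRD.
  by congr (expR _)%:E; field.
rewrite (integral_product_measure_mul _ _ _ _ (lebesgue3 R) (@surface_measure R) g3 (cst 1)) //.
have G0 : (0 <= \int[@lebesgue_measure R]_x (g x)%:E)%E.
  by apply: integral_ge0 => x _; rewrite lee_fin.
have Gfin : (\int[@lebesgue_measure R]_x (g x)%:E \is a fin_num)%E.
  by rewrite ge0_fin_numE// integral_gaussian_lty.
rewrite lte_mul_pinfty//; last 2 first.
- by rewrite [X in X \is a fin_num](integral_product_measure_mul _ _ _ _ (lebesgue2 R)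
     (@lebesgue_measure R) g2 g)// fin_numM//
     [X in X \is a fin_num](integral_product_measure_mul _ _ _ _ (@lebesgue_measure R)
     (@lebesgue_measure R) g g)// fin_numM.
- by rewrite (eq_integral (cst 1%:E))// integral_cst// mul1e -ge0_fin_numE// fin_num_measure.
by apply: integral_ge0 => x _; rewrite lee_fin.
Qed.

Definition grazing (v : vec3 R) : set (mvec3 R * mvec3 R) :=
  [set z | sphere2 z.2 /\ ~ (-1 < cos_deviation v z.1 z.2 < 1)].

Lemma measurable_grazing v : measurable (grazing v).
Proof.
apply: measurableI; first exact: (measurable_preimage_sphere2 snd).
apply: measurableC.
have mc := measurable_cos_deviation v _ _ (@measurable_fst _ _ (mvec3 R) (mvec3 R))
  (@measurable_snd _ _ (mvec3 R) (mvec3 R)).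
have := mc measurableT `]-1, 1[%classic (measurable_itv _); rewrite setTI.
by congr measurable; apply/seteqP; split => z /=; rewrite in_itv.
Qed.

Lemma grazing_null v : (lebesgue3 R \x @surface_measure R)%E (grazing v) = 0%E.
Proof.
rewrite /product_measure1; apply: integral0_eq => w _ /=.
set u : vec3 R := (norm3 (v - w))^-1 *: (v - w).
apply: (surface_measure_pair_null _ u (- u)) => s.
rewrite /xsection /= inE /grazing /= => -[/sphere2_dot3 s1].
rewrite /cos_deviation -/u => /negP; rewrite negb_and -!leNgt.
have := dot3_direction_le1 v w; rewrite -/u; case: u s s1 => [[a b] c] [[x y] z].
rewrite /dot3 /= => s1 u1 /orP[h|h]; [right|left].
- have h1 : (x + a) ^+ 2 + (y + b) ^+ 2 + (z + c) ^+ 2 <= 0 by lra.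
  have := sqr_ge0 (x + a); have := sqr_ge0 (y + b); have := sqr_ge0 (z + c) => z0 y0 x0.
  have /eqP : (x + a) ^+ 2 = 0 by lra.
  have /eqP : (y + b) ^+ 2 = 0 by lra.
  have /eqP : (z + c) ^+ 2 = 0 by lra.
  by rewrite !sqrf_eq0 !addr_eq0 => /eqP-> /eqP-> /eqP->.
- have h1 : (x - a) ^+ 2 + (y - b) ^+ 2 + (z - c) ^+ 2 <= 0 by lra.
  have := sqr_ge0 (x - a); have := sqr_ge0 (y - b); have := sqr_ge0 (z - c) => z0 y0 x0.
  have /eqP : (x - a) ^+ 2 = 0 by lra.
  have /eqP : (y - b) ^+ 2 = 0 by lra.
  have /eqP : (z - c) ^+ 2 = 0 by lra.
  by rewrite !sqrf_eq0 !subr_eq0 => /eqP-> /eqP-> /eqP->.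
Qed.

End ProductIntegrals.

Section KernelBounds.
Context {R : realType}.
Variables (CPhi gamma : R) (b : R -> R).
Hypothesis hB : hard_potential_cutoff CPhi gamma b.
Implicit Types v w s : vec3 R.
Local Notation mV := (mvec3 R).

(* [b] may take any value at [-1] and [1]; truncating it there changes the
   kernel on a null set only and makes it measurable and nonnegative. *)
Definition cut_kernel v w s : R :=
  collision_kernel CPhi gamma (b \_ `]-1, 1[) (norm3 (v - w)) (cos_deviation v w s).

Let CPhi0 : 0 < CPhi. Proof. by have [] := hB. Qed.
Let gamma01 : 0 <= gamma <= 1. Proof. by have [] := hB. Qed.

Lemma cut_angular_ge0 t : 0 <= (b \_ `]-1, 1[) t.
Proof.
rewrite patchE; case: ifPn => // /set_mem /=; rewrite in_itv /= => t1.
by rewrite ltW// (angular_gt0 _ _ _ hB).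
Qed.

Lemma cut_kernel_ge0 v w s : 0 <= cut_kernel v w s.
Proof. by rewrite !mulr_ge0 ?powR_ge0 ?cut_angular_ge0// ltW. Qed.

Lemma cut_kernelE v w s : -1 < cos_deviation v w s < 1 ->
  cut_kernel v w s =
  collision_kernel CPhi gamma b (norm3 (v - w)) (cos_deviation v w s).
Proof.
by move=> h; rewrite /cut_kernel /collision_kernel patchE mem_set//= in_itv.
Qed.

Lemma measurable_cut_kernel v :
  measurable_fun setT (fun z : mV * mV => cut_kernel v z.1 z.2).
Proof.
apply: measurable_funM; first apply: measurable_funM => //.
  apply: (measurableT_comp (measurable_powR _)); apply: measurable_norm3.
  exact: measurable_sub3.
apply: (measurableT_comp (measurable_angular _ _ _ hB)).
exact: measurable_cos_deviation.
Qed.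

Lemma norm3_powRE v (p : R) : norm3 v `^ p = dot3 v v `^ (p / 2).
Proof. by rewrite /norm3 -powR12_sqrt ?dot3_ge0// -powRrM mulrC. Qed.

Lemma speed_powR_le v w : norm3 (v - w) `^ gamma <=
  (1 + dot3 v v) `^ (gamma / 2) * (2 * (1 + dot3 w w)).
Proof.
have /andP[g0 g1] := gamma01; have v0 := dot3_ge0 v; have w0 := dot3_ge0 w.
rewrite norm3_powRE.
apply: (@le_trans _ _ (((1 + dot3 v v) * (2 * (1 + dot3 w w))) `^ (gamma / 2))).
  apply: ge0_ler_powR; rewrite ?nnegrE ?dot3_ge0//; first lra.
    by rewrite !mulr_ge0//; lra.
  have := mulr_ge0 v0 w0.
  have := dot3_ge0 (v + w); move: v0 w0.
  case: v => [[x y] z]; case: w => [[x' y'] z']; rewrite /dot3 /=.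
  by move=> *; lra.
rewrite powRM; try lra.
by rewrite ler_wpM2l ?powR_ge0// ler1_powR; lra.
Qed.

Definition opposite_side (a : R) : set (measurableTypeR R) :=
  if 0 <= a then `[-2, -1]%classic else `[1, 2]%classic.

Lemma opposite_sideP a x : opposite_side a x ->
  1 + a ^+ 2 <= (a - x) ^+ 2 /\ x ^+ 2 <= 4.
Proof.
rewrite /opposite_side; case: ifPn => a0; rewrite /= in_itv /= => /andP[x1 x2].
  by split; nra.
by move: a0; rewrite -ltNge => a0; split; nra.
Qed.

Definition opposite_cube v : set mV :=
  (opposite_side v.1.1 `*` opposite_side v.1.2) `*` opposite_side v.2.

Lemma measurable_opposite_side a : measurable (opposite_side a).
Proof. by rewrite /opposite_side; case: ifPn => _; exact: measurable_itv. Qed.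

Lemma measurable_opposite_cube v : measurable (opposite_cube v).
Proof. by apply: measurableX; first apply: measurableX; exact: measurable_opposite_side. Qed.

Lemma opposite_cube_mass v : lebesgue3 R (opposite_cube v) = 1%E.
Proof.
have side a : @lebesgue_measure R (opposite_side a) = 1%E.
  rewrite /opposite_side; case: ifPn => _; rewrite lebesgue_measure_itv /= lte_fin.
    by rewrite ifT -?EFinD; [congr _%:E|]; lra.
  by rewrite ifT -?EFinD; [congr _%:E|]; lra.
have m a := measurable_opposite_side a.
transitivity (lebesgue2 R (opposite_side v.1.1 `*` opposite_side v.1.2) *
  @lebesgue_measure R (opposite_side v.2))%E.
  by apply: product_measure1E => //; exact: measurableX.
rewrite side mule1; transitivity (@lebesgue_measure R (opposite_side v.1.1) *
  @lebesgue_measure R (opposite_side v.1.2))%E.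
  exact: product_measure1E.
by rewrite !side mule1.
Qed.

Lemma speed_powR_ge v w : opposite_cube v w ->
  (1 + dot3 v v) `^ (gamma / 2) <= norm3 (v - w) `^ gamma.
Proof.
have /andP[g0 g1] := gamma01.
move=> [[/opposite_sideP[h1 _] /opposite_sideP[h2 _]] /opposite_sideP[h3 _]].
rewrite norm3_powRE; apply: ge0_ler_powR; rewrite ?nnegrE ?dot3_ge0//; first lra.
  by rewrite addr_ge0 ?dot3_ge0.
by move: h1 h2 h3; rewrite /dot3 /= -!expr2; lra.
Qed.

Lemma opposite_cube_dot3 v w : opposite_cube v w -> dot3 w w <= 12.
Proof.
move=> [[/opposite_sideP[_ h1] /opposite_sideP[_ h2]] /opposite_sideP[_ h3]].
by rewrite /dot3 -!expr2; lra.
Qed.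

Local Notation dom := (setT `*` sphere2 : set (mV * mV)).
Local Notation mes := (lebesgue3 R \x @surface_measure R)%E.

Lemma measurable_dom : measurable dom.
Proof.
apply: measurableX => //; exact: (measurable_preimage_sphere2 id).
Qed.

Definition radial_average (phi : R -> R) v : \bar R :=
  (\int[mes]_(z in dom) (cut_kernel v z.1 z.2 * phi (dot3 z.1 z.1 / 2))%:E)%E.

Lemma measurable_radial (phi : R -> R) v : measurable_fun setT phi ->
  measurable_fun setT
    (fun z : mV * mV => cut_kernel v z.1 z.2 * phi (dot3 z.1 z.1 / 2)).
Proof.
move=> mphi; apply: measurable_funM; first exact: measurable_cut_kernel.
apply: (measurableT_comp mphi); apply: measurable_funM => //.
exact: measurable_dot3.
Qed.

Lemma radial_average_upper : exists2 C : R, 0 < C &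
  forall (phi : R -> R) (K : R) v, measurable_fun setT phi ->
  (forall x, 0 <= x -> 0 <= phi x) -> 0 <= K ->
  (forall x, 0 <= x -> (1 + 2 * x) * phi x <= K * expR (- (x / 4))) ->
  (radial_average phi v <= (C * K * (1 + dot3 v v) `^ (gamma / 2))%:E)%E.
Proof.
have [M M0 bM] := angular_upper_bound _ _ _ hB.
pose J := (\int[mes]_z (expR (- (dot3 z.1 z.1 / 8)))%:E)%E.
have J0 : (0 <= J)%E by apply: integral_ge0 => z _; rewrite lee_fin expR_ge0.
have Jfin : J \is a fin_num by rewrite ge0_fin_numE// integral_gaussian3_lty.
exists (2 * CPhi * M * (fine J + 1)).
  by rewrite !mulr_gt0// ltr_wpDl// fine_ge0.
move=> phi K v mphi phi0 K0 hK.
set P := _ `^ _; have P0 : 0 <= P by exact: powR_ge0.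
have k0 : 0 <= 2 * CPhi * M * K * P by rewrite !mulr_ge0// ltW.
apply: (@le_trans _ _ (\int[mes]_z ((2 * CPhi * M * K * P)%:E *
    (expR (- (dot3 z.1 z.1 / 8)))%:E))%E); last first.
  rewrite ge0_integralZl//; first last.
  - apply/measurable_EFinP; apply: (measurableT_comp (@measurable_expR R)).
    apply: measurable_funN; apply: measurable_funM => //.
    by apply: measurable_dot3; exact: measurable_fst.
  rewrite -/J -[in leLHS](fineK Jfin) -EFinM lee_fin.
  by move: (fine J) k0 => j; lra.
rewrite /radial_average integral_mkcond.
apply: (ge0_le_integral_off_null measurable0 (measure0 _)).
- move=> z _; apply: erestrict_ge0 => x _; rewrite lee_fin mulr_ge0//.
    exact: cut_kernel_ge0.
  by apply: phi0; rewrite divr_ge0 ?dot3_ge0.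
- by move=> z _; rewrite -EFinM lee_fin mulr_ge0 ?expR_ge0.
move=> [w s] _ _; rewrite patchE; case: ifPn => [_|_]; last first.
  by rewrite -EFinM lee_fin mulr_ge0 ?expR_ge0.
rewrite -EFinM lee_fin /=.
have x0 : 0 <= dot3 w w / 2 by rewrite divr_ge0 ?dot3_ge0.
have bt0 := cut_angular_ge0 (cos_deviation v w s).
have btM : (b \_ `]-1, 1[) (cos_deviation v w s) <= M.
  rewrite patchE; case: ifPn => [/set_mem /=|_]; last by rewrite ltW.
  by rewrite in_itv /=; exact: bM.
rewrite /cut_kernel /collision_kernel.
apply: (@le_trans _ _ (CPhi * (P * (2 * (1 + dot3 w w))) * M * phi (dot3 w w / 2))).
  rewrite ler_wpM2r ?phi0// ler_pM//.
  - by rewrite mulr_ge0 ?powR_ge0// ltW.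
  - by rewrite ler_wpM2l ?(ltW CPhi0)// speed_powR_le.
have := hK _ x0; set p := phi _.
rewrite (_ : dot3 w w / 2 / 4 = dot3 w w / 8); last by field.
set e := expR _; rewrite (_ : 2 * (dot3 w w / 2) = dot3 w w); last by field.
move=> h.
rewrite [leLHS](_ : _ = (2 * CPhi * M * P) * ((1 + dot3 w w) * p)); last by ring.
rewrite [leRHS](_ : _ = (2 * CPhi * M * P) * (K * e)); last by ring.
by rewrite ler_wpM2l// !mulr_ge0// ltW.
Qed.

Lemma radial_average_lower (k : R) (phi : R -> R) : 0 < k ->
  (forall x, 0 <= x -> 0 <= phi x) ->
  (forall x, 0 <= x <= 6 -> k <= phi x) ->
  exists2 c : R, 0 < c &
    forall v, ((c * (1 + dot3 v v) `^ (gamma / 2))%:E <= radial_average phi v)%E.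
Proof.
move=> k0 phi0 hk.
have [m m0 hm] := @surface_measure_transverse R.
have [b0 b00 hb] := angular_lower_bound _ _ _ hB.
exists (CPhi * b0 * k * m); first by rewrite !mulr_gt0.
move=> v; set P := _ `^ _; have P0 : 0 <= P by exact: powR_ge0.
pose E : set (mV * mV) := [set z | opposite_cube v z.1 /\
  (sphere2 z.2 /\ -(9 / 10) <= cos_deviation v z.1 z.2 <= 9 / 10)].
have mE : measurable E.
  apply: measurableI; last apply: measurableI.
  - have := @measurable_fst _ _ mV mV measurableT _ (measurable_opposite_cube v).
    by rewrite setTI.
  - exact: (measurable_preimage_sphere2 snd).
  - have := measurable_cos_deviation v _ _ (@measurable_fst _ _ mV mV)
      (@measurable_snd _ _ mV mV) measurableT `[-(9/10), 9/10]%classic (measurable_itv _).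
    by rewrite setTI; congr measurable; apply/seteqP; split => z /=; rewrite in_itv.
have Em : (m%:E <= mes E)%E.
  rewrite -[m%:E]mule1 -(opposite_cube_mass v) -integral_cst; last first.
    exact: measurable_opposite_cube.
  rewrite [leRHS]/(product_measure1 _ _ _) integral_mkcond.
  apply: (ge0_le_integral_off_null measurable0 (measure0 _)) => //.
    by move=> w _; apply: erestrict_ge0 => x _; rewrite lee_fin ltW.
  move=> w _ _; rewrite patchE; case: ifPn => [/set_mem wQ|_]; last exact: measure_ge0.
  rewrite (le_trans (hm _ (dot3_direction_le1 v w)))// le_eqVlt; apply/orP; left.
  apply/eqP; congr (surface_measure _); apply/seteqP; rewrite /xsection.
  by split => s /=; rewrite inE /E /=; [|case].
apply: (@le_trans _ _ (\int[mes]_(z in E) (cst (CPhi * b0 * k * P)%:E z))%E).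
  rewrite integral_cst// (_ : (_ * _)%:E = (CPhi * b0 * k * P)%:E * m%:E)%E.
    by rewrite lee_wpmul2l// lee_fin !mulr_ge0// ltW.
  by rewrite -EFinM; congr _%:E; ring.
rewrite /radial_average integral_mkcond [leRHS]integral_mkcond.
have F0 z : (0 <= (cut_kernel v z.1 z.2 * phi (dot3 z.1 z.1 / 2))%:E)%E.
  rewrite lee_fin mulr_ge0 ?cut_kernel_ge0// phi0//.
  by rewrite divr_ge0 ?dot3_ge0.
apply: (ge0_le_integral_off_null measurable0 (measure0 _)).
- by move=> z _; apply: erestrict_ge0 => x _; rewrite lee_fin !mulr_ge0// ltW.
- by move=> z _; apply: erestrict_ge0 => x _.
move=> [w s] _ _; rewrite !patchE.
case: ifPn => [/set_mem[/= wQ [ss cI]]|_]; last by case: ifPn.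
rewrite mem_set// lee_fin.
rewrite (_ : _ * P = CPhi * P * b0 * k); last by ring.
have cI' : -1 < cos_deviation v w s < 1 by lra.
rewrite cut_kernelE// /collision_kernel.
apply: ler_pM; rewrite ?mulr_ge0 ?(ltW CPhi0) ?(ltW b00) ?(ltW k0)//.
  apply: ler_pM; rewrite ?mulr_ge0 ?(ltW CPhi0) ?(ltW b00)//; last exact: hb.
  by rewrite ler_wpM2l ?(ltW CPhi0)// speed_powR_ge.
by apply: hk; have := opposite_cube_dot3 _ _ wQ; have := dot3_ge0 w; lra.
Qed.

End KernelBounds.

Section GainLoss.
Context {R : realType}.
Variables (CPhi gamma : R) (b : R -> R).
Hypothesis hB : hard_potential_cutoff CPhi gamma b.
Implicit Types v w s : vec3 R.
Local Notation mV := (mvec3 R).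
Local Notation B := (collision_kernel CPhi gamma b).
Local Notation c := ((2 * pi) `^ (- (3 / 2)) : R).
Local Notation average := (radial_average CPhi gamma b).
Local Notation dom := (setT `*` sphere2 : set (mV * mV)).
Local Notation mes := (lebesgue3 R \x @surface_measure R)%E.

(* Both are taken at |w|^2 / 2. *)
Definition radial_maxwellian (x : R) : R := c * expR (- x).
Definition radial_correction (x : R) : R := c * (x * expR (- (x / 2))).

Let c0 : 0 < c. Proof. exact: maxwellian0_gt0. Qed.

Let measurable_radial_maxwellian : measurable_fun setT radial_maxwellian.
Proof.
apply: measurable_funM => //; apply: (measurableT_comp (@measurable_expR R)).
exact: measurable_funN.
Qed.

Let measurable_radial_correction : measurable_fun setT radial_correction.
Proof.
apply: measurable_funM => //; apply: measurable_funM => //.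
apply: (measurableT_comp (@measurable_expR R)); apply: measurable_funN.
exact: measurable_funM.
Qed.

Let radial_maxwellian_ge0 x : 0 <= x -> 0 <= radial_maxwellian x.
Proof. by move=> _; rewrite mulr_ge0 ?expR_ge0// ltW. Qed.

Let radial_correction_ge0 x : 0 <= x -> 0 <= radial_correction x.
Proof. by move=> x0; rewrite !mulr_ge0 ?expR_ge0// ltW. Qed.

Lemma collision_frequencyE v :
  collision_frequency B v = fine (average radial_maxwellian v).
Proof.
rewrite /collision_frequency /integral_vs /Rintegral; congr fine.
apply: (eq_integral_off_null (measurable_grazing v) (grazing_null v)).
move=> [w s] [_ ss] Nz; rewrite cut_kernelE.
  by rewrite /radial_maxwellian /maxwellian sqr_norm3.
by apply: contrapT => h; apply: Nz.
Qed.

Lemma collision_frequency_correction : exists2 C : R, 0 < C & forall v,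
  [/\ 0 < collision_frequency B v,
      average radial_maxwellian v = (collision_frequency B v)%:E &
      (average radial_correction v <= (C * collision_frequency B v)%:E)%E].
Proof.
have [C C0 hC] := radial_average_upper _ _ _ hB.
have [||l l0 hl] := radial_average_lower _ _ _ hB (c * expR (- 6)) radial_maxwellian _ radial_maxwellian_ge0.
- by rewrite mulr_gt0 ?expR_gt0.
- by move=> x /andP[_ x6]; rewrite ler_wpM2l ?(ltW c0)// ler_expR lerN2.
exists (C * (c * 128) / l) => [|v].
  by rewrite divr_gt0// !mulr_gt0.
set P := (1 + dot3 v v) `^ (gamma / 2).
have P0 : 0 < P by rewrite powR_gt0// ltr_wpDr// dot3_ge0.
have low := hl v; rewrite -/P in low.
have up0 : (average radial_maxwellian v <= (C * (c * 128) * P)%:E)%E.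
  apply: hC => //; first by rewrite mulr_ge0// ltW.
  move=> x x0; rewrite /radial_maxwellian mulrCA -mulrA ler_wpM2l ?(ltW c0)//.
  rewrite (_ : - (x / 4) = - x + (3 * x / 4)); last by field.
  rewrite expRD mulrCA mulrC ler_wpM2l ?expR_ge0//.
  by have := expR_ge1Dx (3 * x / 4); lra.
have up1 : (average radial_correction v <= (C * (c * 128) * P)%:E)%E.
  apply: hC => //; first by rewrite mulr_ge0// ltW.
  move=> x x0; rewrite /radial_correction mulrCA -[leRHS]mulrA ler_wpM2l ?(ltW c0)//.
  by rewrite mulrA [(1 + 2 * x) * x]mulrC gaussian_moment_le.
have fin0 : average radial_maxwellian v = (collision_frequency B v)%:E.
  rewrite collision_frequencyE fineK// ge0_fin_numE ?(le_lt_trans up0) ?ltry//.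
  by rewrite (le_trans _ low)// lee_fin !mulr_ge0// ltW.
rewrite fin0 lee_fin in low.
split => //; first by rewrite (lt_le_trans _ low)// mulr_gt0.
rewrite (le_trans up1)// lee_fin.
rewrite [leRHS](_ : _ = C * (c * 128) * (collision_frequency B v / l)); last by ring.
rewrite ler_wpM2l//; first by rewrite !mulr_ge0// ltW.
by rewrite ler_pdivlMr// mulrC.
Qed.

Lemma K_op_le : exists2 C : R, 0 < C & forall (z M : R) (g : vec3 R -> R) v,
  1 / 2 <= z <= 1 -> 0 <= M -> (forall w, `|g w| <= M * maxwellian w `^ z) ->
  `|K_op B g v| <= M * maxwellian v `^ z *
     ((3 + C * (1 - z)) * collision_frequency B v).
Proof.
have [C C0 hC] := collision_frequency_correction.
exists (3 * C) => [|z M g v /andP[z2 z1] M0 gM]; first by rewrite mulr_gt0.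
have [nu0 nuE corr] := hC v; set nu := collision_frequency B v in nu0 nuE corr *.
set A := M * maxwellian v `^ z; have A0 : 0 <= A by rewrite mulr_ge0 ?powR_ge0.
pose G (y : mV * mV) : \bar R :=
  ((3 * A)%:E * ((cut_kernel CPhi gamma b v y.1 y.2 * radial_maxwellian (dot3 y.1 y.1 / 2))%:E +
    (1 - z)%:E * (cut_kernel CPhi gamma b v y.1 y.2 * radial_correction (dot3 y.1 y.1 / 2))%:E))%E.
have x0 w : 0 <= dot3 w w / 2 by rewrite divr_ge0 ?dot3_ge0.
have G0 y : (0 <= (cut_kernel CPhi gamma b v y.1 y.2 * radial_maxwellian (dot3 y.1 y.1 / 2))%:E)%E.
  by rewrite lee_fin mulr_ge0 ?radial_maxwellian_ge0 ?(cut_kernel_ge0 _ _ _ hB).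
have G1 y : (0 <= (cut_kernel CPhi gamma b v y.1 y.2 * radial_correction (dot3 y.1 y.1 / 2))%:E)%E.
  by rewrite lee_fin mulr_ge0 ?radial_correction_ge0 ?(cut_kernel_ge0 _ _ _ hB).
have mG (phi : R -> R) : measurable_fun setT phi -> measurable_fun dom
    (fun y => (cut_kernel CPhi gamma b v y.1 y.2 * phi (dot3 y.1 y.1 / 2))%:E).
  move=> mphi; apply: measurable_funTS; apply/measurable_EFinP.
  exact: (measurable_radial _ _ _ hB).
have mG0 := mG _ measurable_radial_maxwellian; have mG1 := mG _ measurable_radial_correction.
have z'0 : (0 <= (1 - z)%:E)%E by rewrite lee_fin subr_ge0.
have intG : (\int[mes]_(y in dom) G y <=
    (A * ((3 + 3 * C * (1 - z)) * nu))%:E)%E.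
  rewrite /G ge0_integralZl//; first last.
  - by rewrite lee_fin mulr_ge0.
  - by move=> y _; rewrite adde_ge0// mule_ge0.
  - by apply: emeasurable_funD => //; exact: measurable_funeM.
  - exact: measurable_dom.
  rewrite ge0_integralD//; first last.
  - exact: measurable_funeM.
  - by move=> y _; rewrite mule_ge0.
  - exact: measurable_dom.
  rewrite ge0_integralZl//; last exact: measurable_dom.
  rewrite -!/(radial_average _ _ _ _ _) nuE.
  apply: (@le_trans _ _ ((3 * A)%:E * (nu%:E + (1 - z)%:E * (C * nu)%:E))%E).
    apply: lee_wpmul2l; first by rewrite lee_fin mulr_ge0.
    by apply: leeD2l; apply: lee_wpmul2l.
  by rewrite -(EFinM (1 - z)) -EFinD -EFinM lee_fin le_eqVlt; apply/orP; left; apply/eqP; ring.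
rewrite /K_op /integral_vs /Rintegral.
set I := integral _ _ _.
have : (`|I| <= (A * ((3 + 3 * C * (1 - z)) * nu))%:E)%E; last first.
  by case: I => [r| |] //=; rewrite normr0 lee_fin => _; rewrite !mulr_ge0 ?(ltW nu0)//; lra.
apply: le_trans intG; apply: (abse_integral_le_off_null (measurable_grazing v) (grazing_null v)).
  move=> y _; apply: mule_ge0; first by rewrite lee_fin mulr_ge0.
  by rewrite adde_ge0// mule_ge0.
move=> [w s] [/= _ ss] Nz; rewrite /G /=.
have cI : -1 < cos_deviation v w s < 1.
  by apply: contrapT => h; apply: Nz.
rewrite -(cut_kernelE CPhi gamma) //.
set k := cut_kernel _ _ _ _ _ _; have k0 : 0 <= k by exact: (cut_kernel_ge0 _ _ _ hB).
rewrite -(EFinM (1 - z)) -EFinD -EFinM lee_fin normrM ger0_norm//.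
rewrite [leRHS](_ : _ = k * (3 * (A * (radial_maxwellian (dot3 w w / 2) +
  (1 - z) * radial_correction (dot3 w w / 2))))); last by ring.
rewrite ler_wpM2l//.
have step v' w' : dot3 v' v' + dot3 w' w' = dot3 v v + dot3 w w ->
    `|maxwellian v' * g w'| <=
    A * (radial_maxwellian (dot3 w w / 2) + (1 - z) * radial_correction (dot3 w w / 2)).
  move=> E; rewrite normrM gtr0_norm ?maxwellian_gt0//.
  apply: (@le_trans _ _ (M * (maxwellian v' * maxwellian w' `^ z))).
    by rewrite [leRHS]mulrCA; apply: ler_wpM2l;
      [exact/ltW/maxwellian_gt0|exact: gM].
  rewrite /A -mulrA ler_wpM2l//.
  apply: (le_trans (maxwellian_mul_powR_le _ _ _ _ _ _ E)); first by lra.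
  rewrite ler_wpM2l ?powR_ge0// /radial_maxwellian /radial_correction.
  have a01 : 0 <= 1 - z <= 1 / 2 by lra.
  have := gaussian_taylor _ _ a01 (x0 w).
  rewrite (_ : 1 - (1 - z) = z); last by ring.
  rewrite -[z * dot3 w w / 2]mulrA => h.
  rewrite [leRHS](_ : _ = c * (expR (- (dot3 w w / 2)) +
    (1 - z) * (dot3 w w / 2 * expR (- (dot3 w w / 2 / 2))))); last by ring.
  by rewrite ler_wpM2l ?(ltW c0).
have energy := collision_energy v w s ss.
have s1 := step _ _ energy.
have s2 := step _ _ (etrans (addrC _ _) energy).
have s3 := step v w erefl.
rewrite (_ : 3 * _ = A * (radial_maxwellian (dot3 w w / 2) + (1 - z) * radial_correction (dot3 w w / 2)) *+ 3).
  rewrite mulrSr (le_trans (ler_normB _ _))// lerD//.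
  by rewrite mulr2n (le_trans (ler_normD _ _))// lerD.
by rewrite mulr_natl.
Qed.

End GainLoss.


Theorem lemma5p3 (R : realType) (CPhi gamma : R) (b : R -> R)
  (hB : hard_potential_cutoff CPhi gamma b)
  (Omega : set (vec3 R)) (hOmega : C1_bounded_domain Omega) :
  let B := collision_kernel CPhi gamma b in
  exists CK : R, 0 < CK /\
    forall zeta : R, 1 / 2 <= zeta <= 1 ->
    forall f : vec3 R * vec3 R -> R,
      in_Linfty Omega (fun v => maxwellian v `^ (- zeta)) f ->
      (sup_norm Omega
         (fun v => ((collision_frequency B v)^-1 * maxwellian v `^ (- zeta))%R)
         (fun z => K_op B (fun w => f (z.1, w)) z.2)
       <= (3 + CK * (1 - zeta))%:E *
          sup_norm Omega (fun v => (maxwellian v `^ (- zeta))%R) f)%E.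
Proof.
move=> B; have [C C0 hC] := K_op_le _ _ _ hB.
exists C; split => // z zI f [_ fin].
have [_ _ [p0 Op0] _ _] := hOmega.
have [D D0 hD] := collision_frequency_correction _ _ _ hB.
set S := sup_norm _ _ f in fin *.
have Sub y : Omega y.1 -> ((`|f y| * maxwellian y.2 `^ (- z))%:E <= S)%E.
  by move=> Oy; apply: ereal_sup_ubound; exists y.
have S0 : (0 <= S)%E.
  by apply: le_trans (Sub (p0, p0) Op0); rewrite lee_fin mulr_ge0 ?powR_ge0.
have Sfin : S \is a fin_num by rewrite ge0_fin_numE.
have M0 : 0 <= fine S by exact: fine_ge0.
apply: ge_ereal_sup => _ [[x v] [/= Ox _] <-].
have mu0 w := powR_gt0 z (maxwellian_gt0 w).
have gM w : `|f (x, w)| <= fine S * maxwellian w `^ z.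
  have := Sub (x, w) Ox; rewrite -(fineK Sfin) lee_fin powRN.
  by rewrite ler_pdivrMr.
have [nu0 _ _] := hD v.
rewrite -(fineK Sfin) -EFinM lee_fin powRN -invfM ler_pdivrMr ?mulr_gt0//.
apply: (le_trans (hC z (fine S) _ v zI M0 gM)).
by rewrite le_eqVlt; apply/orP; left; apply/eqP; ring.
Qed.
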